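(* Let $V$ be a finite set with $|V|\ge2$ and let $T:\ell^2(V)\to\ell^2(V)$ be a self-adjoint operator such that $\langle T1_v,1_u\rangle$ is a non-negative integer for all $u,v\in V$ and $\mathrm{vol}_T(\{u\})=d>0$ for all $u\in V$. Let $\rho_1,\dots,\rho_d:V\to V$ be permutations with $T=P_{\rho_1}+\dots+P_{\rho_d}$. Assume $-d$ is not an eigenvalue of $T$. Let $\mathcal G$ be a group acting transitively on $V$ such that the induced action of $\mathcal G$ on $\ell^2(V)$ commutes with $T^2$ and no index two subgroup of $\mathcal G$ acts transitively on $V$. Then: (1) If the induced action of $\mathcal G$ on $\ell^2(V)$ commutes with $T$, then $\mathfrak h_{T^2}>\frac{\mathfrak h_T^2}{20d}$. (2) If for each $1\le i\le d$ and $v\in V$ there is an automorphism or anti-automorphism $\psi_{i,v}$ of $\mathcal G$ such that $P_{\rho_i}P_g(1_v)=P_{\psi_{i,v}(g)}P_{\rho_i}(1_v)$ for all $g\in\mathcal G$, then $\mathfrak h_{T^2}>\frac{\mathfrak h_T^2}{48d}$. Further, if each $\psi_{i,v}$ maps every index two subgroup of $\mathcal G$ to itself, then $\mathfrak h_{T^2}>\frac{\mathfrak h_T^2}{20d}$.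
   Context: $\ell^2(V)$ is the space of functions $V\to\mathbb C$ with $\langle f,g\rangle=\sum_{v}f(v)\overline{g(v)}$; $1_F$ is the indicator of $F\subseteq V$ and $1_v=1_{\{v\}}$. For a permutation $\rho$ of $V$, $P_\rho f(v)=f(\rho^{-1}v)$ (so $P_\rho1_v=1_{\rho(v)}$); for $g\in\mathcal G$, $P_g f(v)=f(g^{-1}v)$ is the induced action. For an operator $T$ and $F\subseteq V$, $\mathrm{vol}_T(F)=\langle T1_V,1_F\rangle$, and the edge Cheeger constant is $\mathfrak h_T=\min_{F\subseteq V,F\ne\emptyset,V}\frac{\langle T1_F,1_{V\setminus F}\rangle}{\min\{\mathrm{vol}_T(F),\mathrm{vol}_T(V\setminus F)\}}$ (defined when all $\mathrm{vol}_T(F)$ for nonempty $F$ are positive reals).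
   Formalization: The formal theorem additionally assumes 𝔥_T > 0; without it the strict inequalities fail, e.g. |V|=2, d=1, ρ_1=id, T=identity, 𝒢=Z/2, where 𝔥_T=𝔥_{T²}=0; whenever 𝔥_T=0 also 𝔥_{T²}=0. *)

(* Defs.v *)
From HB Require Import structures.
From mathcomp Require Import all_boot all_order all_algebra all_fingroup.
From mathcomp Require Import all_classical all_reals.
From mathcomp Require Import complex.

Set Implicit Arguments.
Unset Strict Implicit.
Unset Printing Implicit Defensive.

Import Order.TTheory GRing.Theory Num.Theory.

Local Open Scope complex_scope.
Local Open Scope ring_scope.

(* The regular module R[i]^o makes this a vectType over R[i], so that the
   operators on it are the elements of 'End(ell2 R V). *)
Notation ell2 R V := {ffun V -> R[i]^o}.

Section ell2.
Variables (R : realType) (V : finType).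

Definition dot (f g : ell2 R V) : R[i] := \sum_(v : V) f v * (g v)^*.

Definition ind (F : {set V}) : ell2 R V := [ffun v => (v \in F)%:R].

Definition self_adjoint (T : 'End(ell2 R V)) : Prop :=
  forall f g : ell2 R V, dot (T f) g = dot f (T g).

Definition precomp (h : V -> V) (f : ell2 R V) : ell2 R V := [ffun v => f (h v)].

Fact precomp_is_linear (h : V -> V) : linear (precomp h).
Proof. by move=> a f g; apply/ffunP => v; rewrite !ffunE. Qed.

HB.instance Definition _ (h : V -> V) :=
  GRing.isLinear.Build R[i] (ell2 R V) (ell2 R V) *:%R (precomp h) (precomp_is_linear h).

Definition permop (s : {perm V}) : 'End(ell2 R V) := linfun (precomp (s^-1)%g).

Definition vol (T : 'End(ell2 R V)) (F : {set V}) : R[i] := dot (T (ind [set: V]%SET)) (ind F).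

(* The inner products below are taken through Re only to land in the ordered
   field R: the Cheeger constant is meant for operators T with every
   vol T F (F nonempty) a positive real. *)
Definition cheeger_ratio (T : 'End(ell2 R V)) (F : {set V}) : R :=
  complex.Re (dot (T (ind F)) (ind (~: F)))
    / Num.min (complex.Re (vol T F)) (complex.Re (vol T (~: F))).

Definition proper_nonempty : pred {set V} :=
  [pred F : {set V} | (F != finset.set0) && (F != [set: V]%SET)].

(* The value of the ratio at a minimizer; the default 0 is reached only when
   #|V| <= 1, where there is no proper nonempty F. *)
Definition cheeger (T : 'End(ell2 R V)) : R :=
  if [pick F | proper_nonempty F] is Some F0
  then cheeger_ratio T [arg min_(F < F0 | proper_nonempty F) cheeger_ratio T F]%O
  else 0.

End ell2.

Section actions.
Variables (G : groupType) (V : finType).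

Record left_action := LeftAction {
  act_fun :> G -> V -> V;
  act_one : forall v, act_fun 1%g v = v;
  act_mul : forall g h v, act_fun (g * h)%g v = act_fun g (act_fun h v)
}.

Definition transitive_on (a : left_action) (H : set G) : Prop :=
  forall u v : V, exists2 g, H g & a g u = v.

Definition left_cosets (H : set G) : set (set G) :=
  [set [set (g * h)%g | h in H] | g in [set: G]]%classic.

Definition index_two_subgroup (H : set G) : Prop :=
  group_closed (mem H) /\ (left_cosets H #= `I_2%classic)%card.

Definition automorphism (psi : G -> G) : Prop :=
  bijective psi /\ {morph psi : g h / (g * h)%g}.

Definition antiautomorphism (psi : G -> G) : Prop :=
  bijective psi /\ forall g h, psi (g * h)%g = (psi h * psi g)%g.

Definition actop (R : realType) (a : left_action) (g : G) : 'End(ell2 R V) :=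
  linfun (precomp (a g^-1%g)).

End actions.

(* Main.v *)
(* Write e(X, Y) for the inner product of T 1_X and 1_Y, and let A minimize the
   Cheeger ratio of T^2, with |A| <= |V| / 2.  Since T^2 = T^* T, a small ratio
   means that the sets rho_i(A) almost coincide, so that T nearly swaps A with
   some B = rho_j(A).  As A cup B and A cap B then have few boundary edges,
   the expansion of T makes B nearly the complement of A.  Every translate gA
   has such a partner B' too, because G commutes with T^2, and expansion applied
   to (A cap gA) cup (B cap B') shows that gA nearly equals A or is nearly
   disjoint from it.  Hence H = {g : |A cap gA| > |A| / 2} is a subgroup of index
   at most two.  Averaging |A cap hA| over the image of H in Sym(V) shows that
   H is not transitive, so its orbits have |V| / 2 elements, and that A is nearly
   one of these orbits, O; therefore e(O, O) < |V| / 4.  On the other hand the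
   symmetry assumptions force e(O, O) = 0 or e(O, O) >= |V| / 4, and in the
   first case T is bipartite and -d is an eigenvalue. *)
Require Import Defs.
From mathcomp Require Import all_boot all_order all_algebra all_fingroup.
From mathcomp Require Import zify ring lra.
From mathcomp Require Import all_classical all_reals.
From mathcomp Require Import complex.
(* classical_sets shadows the finset lemmas of the same names. *)
Import boot.fintype boot.finset.

Set Implicit Arguments.
Unset Strict Implicit.
Unset Printing Implicit Defensive.

Import Order.TTheory GRing.Theory Num.Theory.

Local Open Scope complex_scope.
Local Open Scope ring_scope.

(** * Edge counts between vertex sets *)

Section Edges.
Variables (V : finType) (d : nat) (rho : 'I_d -> {perm V}).
Implicit Types X Y Z : {set V}.

(** The inner product of T 1_X and 1_Y as a natural number: edges are the pairs of an index i and a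
    vertex v, with multiplicity, leading from v to [rho i v]. *)
Definition edges X Y : nat := (\sum_(i < d) #|X :&: rho i @^-1: Y|)%N.

Lemma edges_splitr X Y Z :
  edges X Y = (edges X (Y :&: Z) + edges X (Y :\: Z))%N.
Proof.
rewrite -big_split; apply: eq_bigr => i _ /=.
by rewrite preimsetI preimsetD setIA setIDA cardsID.
Qed.

Lemma edges_splitl X Y Z :
  edges X Y = (edges (X :&: Z) Y + edges (X :\: Z) Y)%N.
Proof.
rewrite -big_split; apply: eq_bigr => i _ /=.
by rewrite -(cardsID Z) setIAC setIDAC.
Qed.

Lemma edges_subr X Y Z : Y \subset Z -> (edges X Y <= edges X Z)%N.
Proof. by move=> /setIidPr sYZ; rewrite (edges_splitr X Z Y) sYZ leq_addr. Qed.

Lemma edges_subl X Y Z : X \subset Z -> (edges X Y <= edges Z Y)%N.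
Proof. by move=> /setIidPr sXZ; rewrite (edges_splitl Z Y X) sXZ leq_addr. Qed.

Lemma edgesUr X Y Z : (edges X (Y :|: Z) <= edges X Y + edges X Z)%N.
Proof.
rewrite (edges_splitr X _ Y) leq_add // edges_subr ?subsetIr //.
by apply/subsetP => v; rewrite !inE; case: (v \in Y).
Qed.

Lemma edgesUl X Y Z : (edges (X :|: Y) Z <= edges X Z + edges Y Z)%N.
Proof.
rewrite (edges_splitl _ Z X) leq_add // edges_subl ?subsetIr //.
by apply/subsetP => v; rewrite !inE; case: (v \in X).
Qed.

Lemma edgesT X : edges X setT = (d * #|X|)%N.
Proof.
rewrite /edges (eq_bigr (fun=> #|X|)) ?sum_nat_const ?card_ord // => i _.
by rewrite preimsetT setIT.
Qed.

Lemma edgesC X Y : (edges X Y + edges X (~: Y))%N = (d * #|X|)%N.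
Proof. by rewrite -edgesT (edges_splitr X setT Y) setTI setTD. Qed.

Lemma leq_edges X Y : (edges X Y <= d * #|X|)%N.
Proof. by rewrite -(edgesC X Y) leq_addr. Qed.

Lemma edges_boundaryU X Y :
  (edges (X :|: Y) (~: (X :|: Y)) <= edges X (~: Y) + edges Y (~: X))%N.
Proof.
apply: leq_trans (edgesUl _ _ _) _; rewrite setCU.
by rewrite leq_add // edges_subr ?subsetIr ?subsetIl.
Qed.

Hypothesis edges_sym : forall X Y, edges X Y = edges Y X.

(** Both sides are [d * #|X|] minus the edges between X and Y. Hence X nearly mapped to Y is also Y
    nearly mapped to X. *)
Lemma edges_balanced X Y : #|X| = #|Y| -> edges X (~: Y) = edges Y (~: X).
Proof.
move=> eXY; have := edgesC X Y; rewrite eXY -(edgesC Y X) (edges_sym X Y).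
exact: addnI.
Qed.

(** Complementation turns the bound for unions into one for intersections, because boundary counts
    are symmetric. *)
Lemma edges_boundaryI X Y :
  (edges (X :&: Y) (~: (X :&: Y)) <= edges X (~: Y) + edges Y (~: X))%N.
Proof.
have := edges_boundaryU (~: X) (~: Y).
by rewrite -setCI !setCK edges_sym (edges_sym _ Y) (edges_sym _ X) addnC.
Qed.

(** * Expansion applied to pairs of nearly swapped sets *)

Section Expansion.
Variables (R : realFieldType) (h eps : R).
Hypothesis d_gt0 : (0 < d)%N.
Hypothesis expansion : forall X, (#|X| <= #|~: X|)%N ->
  h * (d * #|X|)%:R <= (edges X (~: X))%:R.

Definition nearly_mapped X Y :=
  #|X| = #|Y| /\ (edges X (~: Y))%:R <= eps * (d * #|X|)%:R.

Let dR_gt0 : 0 < d%:R :> R. Proof. by rewrite ltr0n. Qed.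

Lemma expansion_le1 X : (0 < #|X| <= #|~: X|)%N -> h <= 1.
Proof.
case/andP=> X_gt0 leX.
have le_d : (edges X (~: X))%:R <= (d * #|X|)%:R :> R by rewrite ler_nat leq_edges.
have := le_trans (expansion leX) le_d.
by rewrite ger_pMl // ltr0n muln_gt0 d_gt0.
Qed.

(** Expansion applies to the smaller of X and its complement, and both have the same boundary. *)
Lemma expansion_or X (c : R) : (edges X (~: X))%:R <= c * d%:R ->
  h * #|X|%:R <= c \/ h * #|~: X|%:R <= c.
Proof.
move=> bX; case: (leqP #|X| #|~: X|) => [leX | /ltnW leX]; [left|right];
  rewrite -(ler_pM2r dR_gt0); apply: (le_trans _ bX).
  by apply: (le_trans _ (expansion leX)); rewrite natrM mulrA mulrAC.
rewrite (edges_sym X); have := expansion (X := ~: X); rewrite setCK => /(_ leX).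
by rewrite natrM mulrA mulrAC.
Qed.

(** The union has at most [2 * eps * d * #|X|] boundary edges. It contains X, so if it were the
    small side, [h <= 2 * eps] would follow. *)
Lemma nearly_mapped_cover X Y : nearly_mapped X Y -> (0 < #|X|)%N ->
  2 * eps < h -> h * #|~: (X :|: Y)|%:R <= 2 * eps * #|X|%:R.
Proof.
move=> [eXY bXY] X_gt0 lt_eps.
have bU : (edges (X :|: Y) (~: (X :|: Y)))%:R <= 2 * eps * #|X|%:R * d%:R :> R.
  apply: le_trans (_ : (edges X (~: Y) + edges Y (~: X))%:R <= _).
    by rewrite ler_nat edges_boundaryU.
  rewrite (edges_balanced (esym eXY)) natrD; move: bXY; rewrite natrM; lra.
case: (expansion_or bU) => // leU; exfalso.
have X_gt0R : 0 < #|X|%:R :> R by rewrite ltr0n.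
have leXU : #|X|%:R <= #|X :|: Y|%:R :> R.
  by rewrite ler_nat subset_leq_card ?subsetUl.
have h_gt0 : 0 < h.
  have : 0 <= 2 * eps.
    have : 0 <= eps * (d * #|X|)%:R by apply: (le_trans _ bXY).
    rewrite pmulr_lge0 ?ltr0n ?muln_gt0 ?d_gt0 //; lra.
  lra.
have : h * #|X|%:R <= 2 * eps * #|X|%:R.
  by apply: (le_trans _ leU); rewrite ler_pM2l.
by rewrite ler_pM2r // leNgt lt_eps.
Qed.

Lemma nearly_mapped_disjoint X Y : nearly_mapped X Y ->
  (#|X| <= #|~: X|)%N -> h * #|X :&: Y|%:R <= 2 * eps * #|X|%:R.
Proof.
move=> [eXY bXY] leX.
have leI : (#|X :&: Y| <= #|~: (X :&: Y)|)%N.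
  apply: leq_trans (leq_trans leX _); rewrite subset_leq_card ?subsetIl //.
  by rewrite setCS subsetIl.
rewrite -(ler_pM2r dR_gt0).
apply: le_trans (_ : (edges (X :&: Y) (~: (X :&: Y)))%:R <= _).
  by apply: (le_trans _ (expansion leI)); rewrite natrM mulrA mulrAC.
apply: le_trans (_ : (edges X (~: Y) + edges Y (~: X))%:R <= _).
  by rewrite ler_nat edges_boundaryI.
rewrite (edges_balanced (esym eXY)) natrD; move: bXY; rewrite natrM; lra.
Qed.

(* X cap X' and Y cap Y' are nearly swapped, so their union has a small boundary
   and is almost empty or almost everything. *)
Lemma nearly_mapped_dichotomy X Y X' Y' :
  nearly_mapped X Y -> nearly_mapped X' Y' -> #|X| = #|X'| ->
  (#|X| <= #|~: X|)%N -> 0 <= h ->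
  h * #|X :&: X'|%:R <= 4 * eps * #|X|%:R \/
  h * (#|X|%:R - #|X :&: X'|%:R) <= 4 * eps * #|X|%:R.
Proof.
move=> [eXY bXY] [eXY' bXY'] eX leX h_ge0.
set U := X :&: X'; set W := Y :&: Y'.
have le1 : (edges U (~: W) <= edges X (~: Y) + edges X' (~: Y'))%N.
  rewrite setCI; apply: leq_trans (edgesUr _ _ _) _.
  by rewrite leq_add // edges_subl ?subsetIr ?subsetIl.
have le2 : (edges W (~: U) <= edges Y (~: X) + edges Y' (~: X'))%N.
  rewrite setCI; apply: leq_trans (edgesUr _ _ _) _.
  by rewrite leq_add // edges_subl ?subsetIr ?subsetIl.
have bE : (edges (U :|: W) (~: (U :|: W)))%:R <= 4 * eps * #|X|%:R * d%:R :> R.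
  apply: le_trans (_ : (edges X (~: Y) + edges X' (~: Y') +
      (edges Y (~: X) + edges Y' (~: X')))%:R <= _).
    by rewrite ler_nat (leq_trans (edges_boundaryU _ _)) ?leq_add.
  rewrite (edges_balanced (esym eXY)) (edges_balanced (esym eXY')) !natrD.
  by move: bXY bXY'; rewrite -eX natrM; lra.
case: (expansion_or bE) => bU; [left|right]; apply: (le_trans _ bU);
  apply: ler_wpM2l => //.
  by rewrite ler_nat subset_leq_card ?subsetUl.
(* From [#|W| <= #|X|] and [2 * #|X| <= #|V|], the complement of [U :|: W] has at least
   [#|X| - #|U|] elements. *)
rewrite -natrB ?subset_leq_card ?subsetIl // ler_nat.
have cW : (#|W| <= #|X|)%N by rewrite eXY subset_leq_card ?subsetIl.
have := cardsUI U W; have := cardsC (U :|: W); have := cardsC X; lia.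
Qed.

End Expansion.
End Edges.

(** * Averaging over a finite permutation group *)

Section PermutationGroups.
Variables (V : finType) (P : {group {perm V}}).

(** For u in the orbit of v, the elements of P sending v to u form a coset of the stabilizer of v;
    the orbit-stabilizer formula concludes. *)
Lemma card_sends_into v (X : {set V}) :
  (#|[set p in P | (p : {perm V}) v \in X]| * #|orbit 'P P v| =
   #|P| * #|X :&: orbit 'P P v|)%N.
Proof.
set S := [set p in P | _].
have card_fiber u : u \in X :&: orbit 'P P v ->
    #|[set p in S | (p : {perm V}) v == u]| = #|('C_P[v | 'P])%g|.
  rewrite inE => /andP[uX /orbitP[p Pp /= eu]].
  have <- : #|amove 'P P v ('P%act v p)| = #|('C_P[v | 'P])%g|.
    by rewrite (amove_act 'P v (subsetT P) Pp) card_rcoset.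
  apply: eq_card => q; rewrite !inE /= eu /aperm -!andbA.
  by case: eqP => [-> | _]; rewrite ?andbF // uX.
have -> : #|S| = (\sum_(u in X :&: orbit 'P P v)
    #|[set p in S | (p : {perm V}) v == u]|)%N.
  rewrite -sum1_card (partition_big (fun p : {perm V} => p v)
    (mem (X :&: orbit 'P P v))) /=; last first.
    move=> p; rewrite !inE => /andP[Pp ->] /=.
    by apply/orbitP; exists p.
  by apply: eq_bigr => u _; rewrite -sum1_card; apply: eq_bigl => p; rewrite !inE.
rewrite (eq_bigr _ card_fiber) sum_nat_const -(card_orbit_stab 'P P v).
by rewrite [RHS]mulnC mulnAC -mulnA.
Qed.

(** Double counting of the pairs (p, v) with p in P and both v and p v in A: at least k for each p,
    and given by [card_sends_into] for each v. *)
Lemma average_overlap (A : {set V}) m k :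
  (forall v, #|orbit 'P P v| = m) ->
  (forall p, p \in P -> k <= #|[set v in A | (p : {perm V}) v \in A]|)%N ->
  (k * m <= \sum_(v in A) #|A :&: orbit 'P P v|)%N.
Proof.
move=> card_orb le_k.
rewrite -(leq_pmul2l (cardG_gt0 P)) big_distrr /=.
rewrite -(eq_bigr _ (fun v _ => card_sends_into v A)).
under eq_bigr do rewrite card_orb.
rewrite -big_distrl /= mulnA leq_mul2r; apply/orP; right.
apply: leq_trans (_ : \sum_(p in P) #|[set v in A | (p : {perm V}) v \in A]| <= _)%N.
  by rewrite -sum_nat_const leq_sum.
apply: eq_leq; under eq_bigr do rewrite -sum1_card.
rewrite (exchange_big_dep (mem A)) /=; last by move=> p v _; rewrite inE => /andP[].
by apply: eq_bigr => v vA; rewrite -sum1_card; apply: eq_bigl => p; rewrite !inE vA.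
Qed.

End PermutationGroups.

(** * Orbits of subgroups of a possibly infinite group *)

Section Orbits.
Variables (G : groupType) (V : finType) (a : left_action G V).

Lemma actK g : cancel (a g) (a g^-1%g).
Proof. by move=> v; rewrite -act_mul mulVg act_one. Qed.

Lemma actVK g : cancel (a g^-1%g) (a g).
Proof. by move=> v; rewrite -act_mul mulgV act_one. Qed.

Lemma act_inj g : injective (a g). Proof. exact: can_inj (actK g). Qed.

Definition subgroup (H : set G) : Prop :=
  [/\ H 1%g, forall x y, H x -> H y -> H (x * y)%g & forall x, H x -> H x^-1%g].

(** For a subgroup H this says that the elements of M outside H lie in a single left coset of H,
    without counting cosets. *)
Definition index_le2 (M H : set G) : Prop :=
  forall x y, M x -> M y -> ~ H x -> ~ H y -> H (x^-1 * y)%g.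

Definition act_orbit (H : set G) v : {set V} :=
  [set u | `[< exists2 g, H g & a g v = u >]].

Lemma act_orbitP (H : set G) u v :
  reflect (exists2 g, H g & a g v = u) (u \in act_orbit H v).
Proof. by rewrite inE; apply: asboolP. Qed.

Lemma act_orbit_sub (H K : set G) v : (forall g, H g -> K g) ->
  act_orbit H v \subset act_orbit K v.
Proof.
move=> sHK; apply/subsetP => u /act_orbitP[g Hg e].
by apply/act_orbitP; exists g => //; apply: sHK.
Qed.

(** If t lies in M but not in H, then M is covered by H and t H, so the M-orbit is covered by the
    H-orbit and its image under t. *)
Lemma card_act_orbit_index (M H : set G) v : index_le2 M H ->
  (#|act_orbit M v| <= 2 * #|act_orbit H v|)%N.
Proof.
move=> iMH; case: (pselect (exists2 t, M t & ~ H t)) => [[t Mt nHt] | noM].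
  apply: leq_trans (_ : #|act_orbit H v :|: a t @: act_orbit H v| <= _)%N.
    apply/subset_leq_card/subsetP => u /act_orbitP[g Mg <-].
    rewrite inE; have [Hg | nHg] := pselect (H g).
      by apply/orP; left; apply/act_orbitP; exists g.
    apply/orP; right; apply/imsetP; exists (a (t^-1 * g)%g v).
      by apply/act_orbitP; exists (t^-1 * g)%g => //; apply: iMH.
    by rewrite -act_mul mulgA mulgV mul1g.
  apply: leq_trans (leq_card_setU _ _) _.
  by rewrite (card_imset _ (@act_inj t)) mul2n addnn.
have sMH g : M g -> H g.
  by move=> Mg; apply: contrapT => nHg; apply: noM; exists g.
apply: leq_trans (subset_leq_card (act_orbit_sub v sMH)) _.
by rewrite leq_pmull.
Qed.

Section Subgroup.
Variable H : set G.
Hypothesis sgH : subgroup H.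

Lemma act_orbit_refl v : v \in act_orbit H v.
Proof. by case: sgH => H1 _ _; apply/act_orbitP; exists 1%g; rewrite ?act_one. Qed.

Lemma act_orbit_eq u v : u \in act_orbit H v -> act_orbit H u = act_orbit H v.
Proof.
case: sgH => _ HM HV /act_orbitP[g Hg <-]; apply/setP => w.
apply/act_orbitP/act_orbitP => -[k Hk <-].
  by exists (k * g)%g; rewrite ?act_mul //; apply: HM.
by exists (k * g^-1)%g; rewrite ?act_mul ?actK //; apply: HM => //; apply: HV.
Qed.

Lemma act_orbit_disjoint u v : u \notin act_orbit H v ->
  [disjoint act_orbit H u & act_orbit H v].
Proof.
move=> uNv; rewrite -setI_eq0; apply/eqP/setP => w; rewrite [in RHS]inE in_setI.
apply/negP => /andP[wu wv].
by move: uNv; rewrite -(act_orbit_eq wv) (act_orbit_eq wu) act_orbit_refl.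
Qed.

Definition act_perm g : {perm V} := perm (@act_inj g).

Definition act_image : {set {perm V}} :=
  [set p | `[< exists2 g, H g & act_perm g = p >]].

Lemma act_image_group_set : group_set act_image.
Proof.
case: sgH => H1 HM HV; apply/group_setP; split.
  rewrite inE; apply/asboolP; exists 1%g => //.
  by apply/permP => v; rewrite permE perm1 act_one.
move=> p q; rewrite !inE => /asboolP[x Hx <-] /asboolP[y Hy <-]; apply/asboolP.
(* The order is reversed: permutations compose from left to right, while [a] is a left action. *)
exists (y * x)%g; first by apply: HM.
by apply/permP => v; rewrite permM !permE act_mul.
Qed.

Canonical act_image_group := Group act_image_group_set.

Lemma orbit_act_image v : orbit 'P act_image v = act_orbit H v.
Proof.
apply/setP => u; apply/orbitP/act_orbitP => [[p]|[g Hg <-]].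
  rewrite inE => /asboolP[g Hg <-] /=; rewrite /aperm permE => <-.
  by exists g.
exists (act_perm g); last by rewrite /= /aperm permE.
by rewrite inE; apply/asboolP; exists g.
Qed.

(** The element g represents a permutation in the finite image of H with the least overlap, which is
    at most the average. *)
Lemma act_average_overlap (A : {set V}) m :
  (forall v, #|act_orbit H v| = m) ->
  exists2 g, H g &
    (#|A :&: a g @^-1: A| * m <= \sum_(v in A) #|A :&: act_orbit H v|)%N.
Proof.
move=> card_orb.
have [p Pp min_p] := arg_minnP (fun p : {perm V} => #|[set v in A | p v \in A]|)
  (group1 [group of act_image]).
have : p \in act_image by [].
rewrite inE => /asboolP[g Hg eg]; exists g => //.
have -> : A :&: a g @^-1: A = [set v in A | p v \in A].
  by apply/setP => v; rewrite -eg !inE permE.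
under eq_bigr do rewrite -orbit_act_image.
apply: (@average_overlap _ [group of act_image]) => // v.
by rewrite orbit_act_image.
Qed.

End Subgroup.
End Orbits.

(** * Overlaps of translates, and the sparse orbit of half size *)

Lemma card_setI_trans (V : finType) (X Y Z : {set V}) :
  (#|X :&: Y| + #|Y :&: Z| <= #|Y| + #|X :&: Z|)%N.
Proof.
rewrite -cardsUI leq_add // subset_leq_card //; apply/subsetP => v;
  rewrite !inE; by case: (v \in X); case: (v \in Y); case: (v \in Z).
Qed.

(** The parts of X and Y outside Z share the complement of Z; if it is too small to hold both, X and
    Y must overlap. *)
Lemma card_setI_disjoint (V : finType) (X Y Z : {set V}) :
  (#|X| + #|Y| <= #|~: Z| + #|Z :&: X| + #|Z :&: Y| + #|X :&: Y|)%N.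
Proof.
have := cardsUI (X :\: Z) (Y :\: Z); have := cardsID Z X; have := cardsID Z Y.
have : (#|X :\: Z :|: Y :\: Z| <= #|~: Z|)%N.
  by apply/subset_leq_card/subsetP => v; rewrite !inE; case: (v \in Z).
have : (#|(X :\: Z) :&: (Y :\: Z)| <= #|X :&: Y|)%N.
  apply/subset_leq_card/subsetP => v; rewrite !inE.
  by case: (v \in Z); case: (v \in X).
rewrite !(setIC Z); lia.
Qed.

Section Overlaps.
Variables (R : realFieldType) (G : groupType) (V : finType).
Variables (a : left_action G V) (A : {set V}) (delta : R).

Definition overlap g : nat := #|A :&: a g @^-1: A|.

Definition near_stabilizer : set G := fun g => (#|A| < 2 * overlap g)%N.

Hypothesis G_trans : transitive_on a [set: G]%classic.
Hypothesis A_gt0 : (0 < #|A|)%N.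
Hypothesis A_le : (#|A| <= #|~: A|)%N.
Hypothesis A_ge : #|~: A|%:R <= (1 + delta) * #|A|%:R.
Hypothesis delta_le : delta <= 10^-1.
Hypothesis dichotomy : forall g,
  (overlap g)%:R <= 2 * delta * #|A|%:R \/
  #|A|%:R - (overlap g)%:R <= 2 * delta * #|A|%:R.

Let AR_gt0 : 0 < #|A|%:R :> R. Proof. by rewrite ltr0n. Qed.

Let dA : delta * #|A|%:R <= 10^-1 * #|A|%:R. Proof. by rewrite ler_pM2r. Qed.

Lemma near_stabilizerP g : near_stabilizer g ->
  #|A|%:R - (overlap g)%:R <= 2 * delta * #|A|%:R.
Proof.
move=> Hg; have : #|A|%:R < 2 * (overlap g)%:R :> R.
  by rewrite -(natrM _ 2) ltr_nat.
case: (dichotomy g) => //; move: dA AR_gt0; lra.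
Qed.

Lemma not_near_stabilizerP g : ~ near_stabilizer g ->
  (overlap g)%:R <= 2 * delta * #|A|%:R.
Proof.
move=> /negP nHg; have : 2 * (overlap g)%:R <= #|A|%:R :> R.
  by rewrite -(natrM _ 2) ler_nat leqNgt.
case: (dichotomy g) => //; move: dA AR_gt0; lra.
Qed.

Lemma preim_act g h (X : {set V}) : a (g * h)%g @^-1: X = a h @^-1: (a g @^-1: X).
Proof. by apply/setP => v; rewrite !inE act_mul. Qed.

Lemma card_preim_act g (X : {set V}) : #|a g @^-1: X| = #|X|.
Proof. exact/card_preimset/act_inj. Qed.

Lemma overlap_mul x y :
  #|a y @^-1: A :&: a (x * y)%g @^-1: A| = overlap x.
Proof. by rewrite preim_act -preimsetI card_preim_act. Qed.

(** For products, two overlaps of at least [(1 - 2 * delta) * #|A|] leave one of at least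
    [(1 - 4 * delta) * #|A|], which exceeds half of A. *)
Lemma near_stabilizer_subgroup : subgroup near_stabilizer.
Proof.
split=> [|x y Hx Hy|x].
- rewrite /near_stabilizer /overlap; have -> : a 1%g @^-1: A = A.
    by apply/setP => v; rewrite inE act_one.
  by rewrite setIid mul2n -addnn -{1}[#|A|]addn0 ltn_add2l.
- have := card_setI_trans A (a y @^-1: A) (a (x * y)%g @^-1: A).
  rewrite overlap_mul card_preim_act -/(overlap y) -/(overlap (x * y)) => le_xy.
  have := near_stabilizerP Hx; have := near_stabilizerP Hy.
  rewrite /near_stabilizer -(ltr_nat R) natrM.
  move: le_xy; rewrite -(ler_nat R) !natrD; move: dA AR_gt0; lra.
- rewrite /near_stabilizer; suff -> : overlap x^-1%g = overlap x by [].
  rewrite /overlap -(card_preim_act x) preimsetI -preim_act mulVg setIC.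
  by congr #|pred_of_set (_ :&: _)|; apply/setP => v; rewrite inE act_one.
Qed.

(** Otherwise A and two translates are pairwise nearly disjoint, and packing gives
    [2 * #|A| <= (1 + 7 * delta) * #|A|], impossible for [delta <= 1/10]. *)
Lemma near_stabilizer_index : index_le2 [set: G]%classic near_stabilizer.
Proof.
case: near_stabilizer_subgroup => _ _ HV x y _ _ nHx nHy.
have nHx' : ~ near_stabilizer x^-1%g by move=> /HV; rewrite invgK.
have nHy' : ~ near_stabilizer y^-1%g by move=> /HV; rewrite invgK.
apply: contrapT => /not_near_stabilizerP.
have := not_near_stabilizerP nHx'; have := not_near_stabilizerP nHy'.
have := card_setI_disjoint (a y^-1%g @^-1: A) (a x^-1%g @^-1: A) A.
have := overlap_mul (x^-1 * y)%g y^-1%g; rewrite mulgK => ->.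
rewrite !card_preim_act.
rewrite -/(overlap x^-1%g) -/(overlap y^-1%g) -(ler_nat R) !natrD.
move: dA AR_gt0 A_ge; lra.
Qed.

Local Notation H := near_stabilizer.

Lemma leq_card_orbit v : (#|V| <= 2 * #|act_orbit a H v|)%N.
Proof.
have := card_act_orbit_index a v near_stabilizer_index.
suff -> : act_orbit a [set: G]%classic v = [set: V]%SET by rewrite cardsT.
by apply/setP => u; rewrite [RHS]inE; apply/act_orbitP; apply: G_trans.
Qed.

(** If H were transitive, some g in H would have overlap at most [#|A| ^ 2 / #|V|], hence at most
    half of [#|A|]. *)
Lemma act_orbit_not_full v : act_orbit a H v <> [set: V]%SET.
Proof.
move=> full_v; have full u : act_orbit a H u = [set: V]%SET.
  rewrite -full_v; apply: act_orbit_eq; first exact: near_stabilizer_subgroup.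
  by rewrite full_v.
have card_orb u : #|act_orbit a H u| = #|V| by rewrite full cardsT.
have [g Hg] := act_average_overlap near_stabilizer_subgroup A card_orb.
under eq_bigr do rewrite full setIT.
rewrite sum_nat_const -(cardsC A) -/(overlap g).
move: Hg A_le; rewrite /near_stabilizer; nia.
Qed.

(** There are at least two disjoint orbits, each containing at least half of V. *)
Lemma card_orbitE v : (2 * #|act_orbit a H v|)%N = #|V|.
Proof.
apply/eqP; rewrite eqn_leq leq_card_orbit andbT.
have /existsP[u uNv] : [exists u, u \notin act_orbit a H v].
  rewrite -negb_forall; apply/negP => /forallP all_v.
  by apply: (@act_orbit_not_full v); apply/setP => u; rewrite all_v inE.
have := act_orbit_disjoint near_stabilizer_subgroup uNv.
rewrite -leq_card_setU => /eqP.
have : (#|act_orbit a H u :|: act_orbit a H v| <= #|V|)%N by apply: max_card.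
have := leq_card_orbit u; have := leq_card_orbit v; lia.
Qed.

Lemma exists_near_orbit : exists v,
  #|A|%:R - #|A :&: act_orbit a H v|%:R <= 8 / 7 * delta * #|A|%:R.
Proof.
have /card_gt0P[v0 Av0] := A_gt0.
have [v Av max_v] := arg_maxnP (fun v => #|A :&: act_orbit a H v|) Av0.
exists v; have sg := near_stabilizer_subgroup.
set O := act_orbit a H v; set m := #|A :&: O|.
have card_orb u : #|act_orbit a H u| = #|O|.
  by have := card_orbitE u; have := card_orbitE v; rewrite -/O; lia.
have [g Hg] := act_average_overlap sg A card_orb.
rewrite -/(overlap g) => le_sum.
(* This crude bound yields [m >= 4/5 * #|A|]. It excludes small m, which the quadratic bound below
   would also allow. *)
have le_sum1 : (\sum_(u in A) #|A :&: act_orbit a H u| <= #|A| * m)%N.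
  by rewrite -sum_nat_const; apply: leq_sum => u /max_v.
(* Points of A in O contribute m each; the orbit of any other point avoids O, so it meets A inside
   [A :\: O]. *)
have le_sum2 : (\sum_(u in A) #|A :&: act_orbit a H u| <=
    m * m + (#|A| - m) * (#|A| - m))%N.
  rewrite (bigID (mem O)) /= leq_add //.
    rewrite (eq_bigr (fun=> m)); last first.
      by move=> u /andP[_ uO]; rewrite (act_orbit_eq sg uO).
    by rewrite sum_nat_cond_const; apply/eq_leq; congr (_ * _)%N.
  have -> : (#|A| - m)%N = #|A :\: O| by rewrite -(cardsID O A) addKn.
  apply: leq_trans (_ : \sum_(u in A | u \notin O) #|A :\: O| <= _)%N; last first.
    rewrite sum_nat_cond_const; apply/eq_leq; congr (_ * _)%N.
    by apply: eq_card => u; rewrite !inE andbC.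
  apply: leq_sum => u /andP[_ /(act_orbit_disjoint sg) dis].
  apply/subset_leq_card/subsetP => w.
  rewrite in_setI in_setD => /andP[-> wu].
  by rewrite andbT (disjointFr dis).
have A_le_O : (#|A| <= #|O|)%N.
  by have := card_orbitE v; have := cardsC A; move: A_le; rewrite -/O; lia.
have m_le : (m <= #|A|)%N by rewrite subset_leq_card ?subsetIl.
have := near_stabilizerP Hg.
have le1 : (overlap g * #|A| <= #|A| * m)%N.
  by apply: leq_trans le_sum1; apply: leq_trans le_sum;
    rewrite leq_mul2l A_le_O orbT.
have le2 : (overlap g * #|A| <= m * m + (#|A| - m) * (#|A| - m))%N.
  by apply: leq_trans le_sum2; apply: leq_trans le_sum;
    rewrite leq_mul2l A_le_O orbT.
move: le1 le2 (m_le) dA; rewrite -!(ler_nat R) natrD !natrM natrB //.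
move: AR_gt0; set x : R := #|A|%:R; set y : R := m%:R.
set z : R := (overlap g)%:R; clearbody x y z.
move=> x_gt0 le1 le2 y_le d_le le3.
have zy : z <= y by rewrite -(ler_pM2r x_gt0) [y * _]mulrC.
have yx : 0 <= x - y by lra.
(* Expand [y^2 + (x - y)^2 = x^2 - 2 * y * (x - y)] and compare with [z >= (1 - 2 * delta) * x]. *)
have le4 : (x - y) * y <= delta * x * x.
  have : (x - 2 * delta * x) * x <= z * x by rewrite ler_pM2r //; lra.
  lra.
have low c : c * x <= y -> (x - y) * c <= delta * x.
  move=> /(ler_wpM2l yx) le_c; rewrite -(ler_pM2r x_gt0).
  by apply: le_trans le4; rewrite -mulrA.
(* The bound for c = 4/5 yields 7/8 * x <= y, hence the bound for c = 7/8. *)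
have := low (4 / 5); have := low (7 / 8); lra.
Qed.

End Overlaps.

Lemma sparse_half_orbit (R : realFieldType) (G : groupType) (V : finType)
    (a : left_action G V) (d : nat) (rho : 'I_d -> {perm V}) (h eps : R)
    (A : {set V}) :
  transitive_on a [set: G]%classic -> (0 < d)%N ->
  (forall X Y, edges rho X Y = edges rho Y X) ->
  (forall X : {set V}, (#|X| <= #|~: X|)%N ->
     h * (d * #|X|)%:R <= (edges rho X (~: X))%:R) ->
  0 < h -> 20 * d%:R * eps <= h ^+ 2 -> (0 < #|A| <= #|~: A|)%N ->
  (forall g, exists Y, nearly_mapped rho eps (a g @^-1: A) Y) ->
  exists H v, [/\ subgroup H, index_le2 [set: G]%classic H,
    (2 * #|act_orbit a H v|)%N = #|V| &
    (4 * edges rho (act_orbit a H v) (act_orbit a H v) < #|V|)%N].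
Proof.
move=> G_trans d_gt0 e_sym expand h_gt0 eps_le A_half images.
have /andP[A_gt0 A_le] := A_half.
have AR_gt0 : 0 < #|A|%:R :> R by rewrite ltr0n.
have dR_ge1 : 1 <= d%:R :> R by rewrite ler1n.
have h_le1 : h <= 1 := expansion_le1 d_gt0 expand A_half.
have [B AB] : exists Y, nearly_mapped rho eps A Y.
  have [Y] := images 1%g; suff -> : a 1%g @^-1: A = A by exists Y.
  by apply/setP => v; rewrite inE act_one.
have eps_ge0 : 0 <= eps.
  have : 0 <= eps * (d * #|A|)%:R by case: AB => _; apply: le_trans.
  by rewrite pmulr_lge0 // ltr0n muln_gt0 d_gt0.
(* The relative error left when a boundary of [2 * eps * d * #|A|] edges is divided by the
   expansion. *)
pose delta := 2 * eps / h.
have hdelta : h * delta = 2 * eps by rewrite mulrC divfK ?gt_eqF.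
have delta_ge0 : 0 <= delta by rewrite divr_ge0 ?mulr_ge0 // ltW.
have ddelta_le : 10 * d%:R * delta <= 1.
  rewrite -(ler_pM2l h_gt0) (_ : h * (_ * delta) = 10 * d%:R * (2 * eps)); last first.
    by rewrite -hdelta; ring.
  apply: le_trans (_ : h ^+ 2 <= _); first by move: eps_le; lra.
  by rewrite expr2 ler_pM2l.
have delta_le : delta <= 10^-1.
  have := ler_wpM2r delta_ge0 dR_ge1; lra.
have eps_lt : 2 * eps < h by rewrite -hdelta gtr_pMr //; lra.
have cover_le : #|~: (A :|: B)|%:R <= delta * #|A|%:R.
  rewrite -(ler_pM2l h_gt0) mulrA hdelta.
  exact: (nearly_mapped_cover e_sym d_gt0 expand AB).
have inter_le : #|A :&: B|%:R <= delta * #|A|%:R.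
  rewrite -(ler_pM2l h_gt0) mulrA hdelta.
  exact: (nearly_mapped_disjoint e_sym d_gt0 expand AB).
have A_ge : #|~: A|%:R <= (1 + delta) * #|A|%:R.
  have : (#|~: A| <= #|B| + #|~: (A :|: B)|)%N.
    apply: leq_trans (leq_card_setU _ _); apply/subset_leq_card.
    by apply/subsetP => v; rewrite !inE; case: (v \in A); case: (v \in B).
  by case: AB => <- _; rewrite -(ler_nat R) natrD; move: cover_le; lra.
have dich g : (overlap a A g)%:R <= 2 * delta * #|A|%:R \/
    #|A|%:R - (overlap a A g)%:R <= 2 * delta * #|A|%:R.
  have [Y XY] := images g.
  have eX : #|A| = #|a g @^-1: A| by rewrite card_preim_act.
  have := nearly_mapped_dichotomy e_sym d_gt0 expand AB XY eX A_le (ltW h_gt0).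
  have -> : 4 * eps = h * (2 * delta) by rewrite mulrCA hdelta; ring.
  by rewrite -mulrA !ler_pM2l.
have [v close] := exists_near_orbit G_trans A_gt0 A_le A_ge delta_le dich.
exists (near_stabilizer a A), v.
have cardO := card_orbitE G_trans A_gt0 A_le A_ge delta_le dich v.
split=> //.
- exact: (near_stabilizer_subgroup A_gt0 delta_le dich).
- exact: (near_stabilizer_index A_gt0 A_ge delta_le dich).
set O := act_orbit _ _ v in close cardO *.
have le_OO : (edges rho O O <= edges rho A A + 2 * (d * #|O :\: A|))%N.
  rewrite (edges_splitr _ O O A) mul2n -addnn addnA leq_add //.
    rewrite (edges_splitl _ O _ A) leq_add //.
      apply: leq_trans (edges_subr _ _ _) (edges_subl _ _ _); exact: subsetIr.
    exact: leq_edges.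
  by rewrite e_sym leq_edges.
have le_AA : (edges rho A A <= edges rho A (~: B) + d * #|A :&: B|)%N.
  rewrite (edges_splitr _ A A B) addnC leq_add //.
    by rewrite edges_subr // setDE subsetIr.
  by rewrite e_sym leq_edges.
rewrite -(ltr_nat R) natrM.
have := cardsID A O; rewrite (setIC O) => /(congr1 (fun n => n%:R : R)).
rewrite natrD => card_OA.
have := cardsC A => /(congr1 (fun n => n%:R : R)); rewrite natrD => card_A.
move: le_OO le_AA; rewrite -!(ler_nat R) !natrD !natrM.
move/(congr1 (fun n => n%:R : R)): cardO; rewrite natrM.
case: AB => _; rewrite natrM; move: A_le; rewrite -(ler_nat R).
move=> A_leR leAB eO leOO leAA.
have d_ge0 : 0 <= d%:R :> R by rewrite ler0n.
have dx_ge0 : 0 <= d%:R * #|A|%:R :> R by rewrite mulr_ge0.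
have eps_le2 : eps <= delta / 2.
  by have := ler_wpM2r delta_ge0 h_le1; rewrite hdelta; lra.
(* Here 23/14 = 1/2 + 8/7: O exceeds A in size by at most [delta / 2 * #|A|], and misses at most
   [8/7 * delta * #|A|] of A. *)
have OA_le : #|O :\: A|%:R <= 23 / 14 * delta * #|A|%:R.
  by move: card_OA card_A eO close A_ge; lra.
have := ler_wpM2r dx_ge0 eps_le2; have := ler_wpM2l d_ge0 OA_le.
have := ler_wpM2l d_ge0 inter_le; have := ler_wpM2r (ltW AR_gt0) ddelta_le.
have leAV : 2 * #|A|%:R <= #|V|%:R :> R by lra.
(* In total [edges rho O O] is at most (1/2 + 1 + 23/7) d delta |A| = 67/14 d delta |A|, which is at
   most 67/140 |A| and so below |V|/4. *)
move: AR_gt0 leAB leOO leAA leAV; lra.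
Qed.

(** * Permutation images, inner products and Cheeger minimizers *)

Lemma imset_permE (V : finType) (s : {perm V}) (X : {set V}) :
  s @: X = s^-1%g @^-1: X.
Proof.
apply/setP => v; rewrite inE; apply/imsetP/idP => [[u uX ->]|vX].
  by rewrite permK.
by exists (s^-1%g v); rewrite ?permKV.
Qed.

Lemma imset_permC (V : finType) (s : {perm V}) (X : {set V}) :
  s @: (~: X) = ~: (s @: X).
Proof. by rewrite !imset_permE preimsetC. Qed.

Lemma card_setI_imset (V : finType) (s : {perm V}) (X Y : {set V}) :
  #|X :&: s @^-1: Y| = #|(s @: X) :&: Y|.
Proof.
rewrite imset_permE -[RHS](card_preimset _ (@perm_inj _ s)) preimsetI.
by congr #|pred_of_set (_ :&: _)|; apply/setP => v; rewrite !inE permK.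
Qed.

Section Operators.
Variables (R : realType) (V : finType).
Implicit Types (X Y F : {set V}) (S : 'End(ell2 R V)).

Lemma Re_nat n : complex.Re (n%:R : R[i]) = n%:R.
Proof. by rewrite -(rmorph_nat (real_complex R)). Qed.

Lemma dot_ind X Y : dot (ind R X) (ind R Y) = #|X :&: Y|%:R.
Proof.
rewrite /dot -sum1_card natr_sum [RHS]big_mkcond /=.
apply: eq_bigr => v _; rewrite !ffunE !inE.
by case: (v \in X); case: (v \in Y); rewrite /= ?conjC1 ?conjC0 ?mul0r ?mulr1 ?mulr0.
Qed.

Lemma dot_suml I (r : seq I) (f : I -> ell2 R V) (g : ell2 R V) :
  dot (\sum_(i <- r) f i) g = \sum_(i <- r) dot (f i) g.
Proof.
rewrite /dot exchange_big; apply: eq_bigr => v _.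
by rewrite sum_ffunE mulr_suml.
Qed.

Lemma dotC (f g : ell2 R V) : dot f g = (dot g f)^*.
Proof.
rewrite /dot rmorph_sum; apply: eq_bigr => v _ /=.
by rewrite rmorphM /= conjCK mulrC.
Qed.

Lemma dot_sumr I (r : seq I) (f : I -> ell2 R V) (g : ell2 R V) :
  dot g (\sum_(i <- r) f i) = \sum_(i <- r) dot g (f i).
Proof.
rewrite dotC dot_suml rmorph_sum; apply: eq_bigr => i _.
by rewrite [RHS]dotC.
Qed.

Lemma permop_ind (s : {perm V}) X : permop R s (ind R X) = ind R (s @: X).
Proof.
by rewrite lfunE /=; apply/ffunP => v; rewrite !ffunE imset_permE inE.
Qed.

Lemma cheeger_le S F : proper_nonempty F -> cheeger S <= cheeger_ratio S F.
Proof.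
rewrite /cheeger; case: pickP => [F0 pF0 pF | /(_ F) -> //].
by case: arg_minP => // F1 _ /(_ F pF).
Qed.

Lemma cheeger_attained S : (2 <= #|V|)%N ->
  exists2 F, proper_nonempty F & cheeger S = cheeger_ratio S F.
Proof.
move=> V_ge2; rewrite /cheeger; case: pickP => [F0 pF0 | none].
  by case: arg_minP => // F1 pF1 _; exists F1.
(* The default value is excluded: a singleton is proper and nonempty. *)
have /card_gt0P[v _] : (0 < #|V|)%N by apply: leq_trans V_ge2.
have /negP[] := negbT (none [set v]%SET).
rewrite /proper_nonempty /= -cards_eq0 cards1 /=; apply/eqP => eT.
by move: V_ge2; rewrite -cardsT -eT cards1.
Qed.

Variables (G : groupType) (a : left_action G V).

Lemma actop_ind g X : actop R a g (ind R X) = ind R (a g^-1%g @^-1: X).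
Proof. by rewrite lfunE /=; apply/ffunP => v; rewrite !ffunE inE. Qed.

Lemma dot_actop g (f f' : ell2 R V) :
  dot (actop R a g f) (actop R a g f') = dot f f'.
Proof.
rewrite /dot [RHS](reindex_inj (@act_inj _ _ a g^-1%g)).
by apply: eq_bigr => v _; rewrite !lfunE /= !ffunE.
Qed.

Lemma dot_preim_act S g X Y :
  (forall h, (actop R a h \o S = S \o actop R a h)%VF) ->
  dot (S (ind R (a g @^-1: X))) (ind R (a g @^-1: Y)) =
  dot (S (ind R X)) (ind R Y).
Proof.
move=> comm; rewrite -{1 2}[g]invgK -!actop_ind.
have /lfunP/(_ (ind R X)) := comm g^-1%g; rewrite !comp_lfunE => <-.
exact: dot_actop.
Qed.

End Operators.

(** * The operator T and its square in terms of edge counts *)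

Section PermutationSums.
Variables (R : realType) (V : finType) (T : 'End(ell2 R V)) (d : nat).
Variable rho : 'I_d -> {perm V}.
Hypothesis T_sa : self_adjoint T.
Hypothesis T_perm : T = \sum_(i < d) permop R (rho i).
Implicit Types X Y F : {set V}.

(** The inner product of T^2 1_X and 1_Y, written as that of T 1_X and T 1_Y with the second factor
    expanded; this gives one summand per [rho j]. *)
Definition edges2 X Y : nat := (\sum_(j < d) edges rho X (rho j @: Y))%N.

Lemma apply_ind X : T (ind R X) = \sum_(i < d) ind R (rho i @: X).
Proof. by rewrite T_perm sum_lfunE; apply: eq_bigr => i _; rewrite permop_ind. Qed.

Lemma dot_edges X Y : dot (T (ind R X)) (ind R Y) = (edges rho X Y)%:R.
Proof.
rewrite apply_ind dot_suml natr_sum; apply: eq_bigr => i _.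
by rewrite dot_ind card_setI_imset.
Qed.

Lemma edges_symmetric X Y : edges rho X Y = edges rho Y X.
Proof.
suff : (edges rho X Y)%:R = (edges rho Y X)%:R :> R[i].
  by move/eqP; rewrite eqr_nat => /eqP.
by rewrite -dot_edges T_sa dotC dot_edges rmorph_nat.
Qed.

Lemma dot_edges2 X Y : dot ((T \o T)%VF (ind R X)) (ind R Y) = (edges2 X Y)%:R.
Proof.
rewrite comp_lfunE T_sa [in X in dot _ X]apply_ind dot_sumr natr_sum.
by apply: eq_bigr => j _; rewrite dot_edges.
Qed.

Lemma edges2C X Y : edges2 X Y = edges2 Y X.
Proof.
rewrite /edges2 /edges exchange_big; apply: eq_bigr => i _; apply: eq_bigr => j _.
by rewrite !card_setI_imset setIC.
Qed.

Lemma edges2T X : edges2 [set: V]%SET X = (d * (d * #|X|))%N.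
Proof.
rewrite /edges2 (eq_bigr (fun=> d * #|X|)%N) ?sum_nat_const ?card_ord // => j _.
by rewrite edges_symmetric edgesT card_imset //; apply: perm_inj.
Qed.

Lemma cheeger_ratioE F : cheeger_ratio T F =
  (edges rho F (~: F))%:R / Num.min (d * #|F|)%:R (d * #|~: F|)%:R.
Proof.
rewrite /cheeger_ratio /vol !dot_edges !(edges_symmetric [set: V]%SET).
by rewrite !edgesT !Re_nat.
Qed.

Lemma cheeger_ratio2E F : cheeger_ratio (T \o T)%VF F =
  (edges2 F (~: F))%:R / Num.min (d * (d * #|F|))%:R (d * (d * #|~: F|))%:R.
Proof. by rewrite /cheeger_ratio /vol !dot_edges2 !edges2T !Re_nat. Qed.

(* Every rho i swaps O and its complement; the eigenvector is 1_O - 1_(~: O). *)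
Lemma bipartite_eigenvalue (O : {set V}) :
  (0 < #|V|)%N -> (2 * #|O|)%N = #|V| -> edges rho O O = 0%N ->
  passmx.leigenvalue T (- d%:R).
Proof.
move=> V_gt0 cardO eO.
have swap i : rho i @: O = ~: O.
  apply/eqP; rewrite eqEcard; apply/andP; split; last first.
    rewrite card_imset; last exact: perm_inj.
    by have := cardsC O; move: cardO; lia.
  apply/subsetP => _ /imsetP[v vO ->]; rewrite inE; apply/negP => rvO.
  have : v \in O :&: rho i @^-1: O by rewrite !inE vO.
  have /eqP : #|O :&: rho i @^-1: O| = 0%N.
    by apply/eqP; move/eqP: eO; rewrite sum_nat_eq0 => /forallP/(_ i).
  by rewrite cards_eq0 => /eqP ->; rewrite inE.
have swapC i : rho i @: (~: O) = O by rewrite imset_permC swap setCK.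
pose f := ind R O - ind R (~: O).
have Tf : T f = - d%:R *: f.
  rewrite linearB /= !apply_ind.
  under eq_bigr do rewrite swap.
  under [X in _ - X]eq_bigr do rewrite swapC.
  by rewrite !sumr_const card_ord scaleNr scaler_nat -mulrnBl -mulNrn opprB.
have f_neq0 : f != 0.
  have [v _] : exists v : V, v \in [set: V]%SET by apply/card_gt0P; rewrite cardsT.
  apply/eqP => /ffunP/(_ v); rewrite !ffunE !inE => /eqP.
  by case: (v \in O); rewrite /= ?subr0 ?sub0r ?oppr_eq0 oner_eq0.
apply: contra f_neq0 => /eqP ker0.
rewrite -memv0 -ker0 memv_ker; apply/eqP.
by rewrite add_lfunE opp_lfunE scale_lfunE id_lfunE Tf subrr.
Qed.

Hypothesis d_gt0 : (0 < d)%N.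

Lemma cheeger_expansion X : (#|X| <= #|~: X|)%N ->
  cheeger T * (d * #|X|)%:R <= (edges rho X (~: X))%:R.
Proof.
move=> leX; have [/eqP|X_gt0] := posnP #|X|.
  by rewrite cards_eq0 => /eqP ->; rewrite cards0 muln0 mulr0.
rewrite -ler_pdivlMr ?ltr0n ?muln_gt0 ?d_gt0 //.
have pX : proper_nonempty X.
  rewrite /proper_nonempty /= -cards_eq0 -lt0n X_gt0 /=.
  apply: contraTneq leX => ->; rewrite -ltnNge setCT cards0 cardsT.
  by apply: leq_trans X_gt0 (max_card _).
apply: le_trans (cheeger_le T pX) _; rewrite cheeger_ratioE.
by rewrite min_l // ler_nat leq_mul2l leX orbT.
Qed.

(** A minimizer may be replaced by its complement, which has the same ratio, so the smaller one is
    taken. *)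
Lemma cheeger2_attained : (2 <= #|V|)%N ->
  exists2 A : {set V}, (0 < #|A| <= #|~: A|)%N &
    (edges2 A (~: A))%:R = cheeger (T \o T)%VF * (d * (d * #|A|))%:R.
Proof.
move=> V_ge2; have [F /andP[F0 FT] ->] := cheeger_attained (T \o T)%VF V_ge2.
have F_gt0 : (0 < #|F|)%N by rewrite lt0n cards_eq0.
have FC_gt0 : (0 < #|~: F|)%N.
  rewrite lt0n cards_eq0; apply: contra FT => /eqP e.
  by rewrite -[F]setCK e setC0.
rewrite cheeger_ratio2E; have [leF | /ltnW leF] := leqP #|F| #|~: F|.
  exists F; first by rewrite F_gt0.
  rewrite min_l ?divfK ?pnatr_eq0 ?ler_nat ?leq_mul //.
  by rewrite -lt0n !muln_gt0 d_gt0.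
exists (~: F); first by rewrite FC_gt0 setCK.
rewrite setCK edges2C min_r ?divfK ?pnatr_eq0 ?ler_nat ?leq_mul //.
by rewrite -lt0n !muln_gt0 d_gt0.
Qed.

(** Pigeonhole: one of the d summands is at most their average, and Y is the corresponding
    [rho j @: X]. *)
Lemma edges2_nearly_mapped X (eps : R) :
  (edges2 X (~: X))%:R <= eps * (d * (d * #|X|))%:R ->
  exists Y, nearly_mapped rho eps X Y.
Proof.
move=> le2; have /existsP[j le_j] : [exists j,
    (edges rho X (~: (rho j @: X)))%:R <= eps * (d * #|X|)%:R].
  rewrite -[X in is_true X]negbK negb_exists; apply/negP => /forallP gt_j.
  move: le2; apply/negP; rewrite -ltNge natr_sum natrM mulrCA mulr_natl.
  rewrite -[X in _ *+ X]card_ord -sumr_const.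
  apply: ltr_sum => [|j _]; last by rewrite imset_permC ltNge gt_j.
  by apply/hasP; exists (Ordinal d_gt0); rewrite ?mem_index_enum.
by exists (rho j @: X); split=> //; rewrite card_imset //; apply: perm_inj.
Qed.

End PermutationSums.

(** * Lower bounds for the edges inside an orbit *)

Section EdgesInsideOrbits.
Variables (G : groupType) (V : finType) (a : left_action G V).
Variables (d : nat) (rho : 'I_d -> {perm V}) (H : set G).
Hypothesis sgH : subgroup H.

(** All vertices of O send the same number of edges into O, so the count is a multiple of [#|O|]. *)
Lemma edges_orbit_invariant v :
  (forall g (X Y : {set V}),
     edges rho (a g @^-1: X) (a g @^-1: Y) = edges rho X Y) ->
  let O := act_orbit a H v in
  edges rho O O = 0%N \/ (#|O| <= edges rho O O)%N.
Proof.
move=> inv O; have [_ HM HV] := sgH.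
have edges1 u : u \in O -> edges rho [set u] O = edges rho [set v] O.
  case/act_orbitP=> g Hg <-; rewrite -(inv g); congr edges.
    by apply/setP => w; rewrite !inE (inj_eq (@act_inj _ _ _ _)).
  apply/setP => w; rewrite [LHS]inE.
  apply/act_orbitP/act_orbitP => -[k Hk e].
    exists (g^-1 * k)%g; first by apply: HM => //; apply: HV.
    by rewrite act_mul e actK.
  by exists (g * k)%g; rewrite ?act_mul ?e //; apply: HM.
clearbody O; have -> : edges rho O O = (#|O| * edges rho [set v] O)%N.
  rewrite -sum_nat_const -(eq_bigr _ edges1) /edges exchange_big /=.
  apply: eq_bigr => i _; rewrite -sum1_card big_mkcond [RHS]big_mkcond.
  apply: eq_bigr => u _; rewrite !inE; case: (u \in O) => //=.
  case: ifP => rO.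
    have /setIidPl -> : [set u]%SET \subset rho i @^-1: O.
      by rewrite sub1set inE.
    by rewrite cards1.
  rewrite [_ :&: _](_ : _ = set0) ?cards0 //; apply/eqP.
  by rewrite setI_eq0 disjoints1 inE rO.
case: (edges rho [set v] O) => [|k]; first by left; rewrite muln0.
by right; apply: leq_pmulr.
Qed.

(* rho i maps O to an orbit of psi(H), and the intersection of H and psi(H) has
   index at most two in H. *)
Lemma edges_orbit_twisted i v w (psi : G -> G) :
  index_le2 [set: G]%classic H ->
  automorphism psi \/ antiautomorphism psi ->
  (forall g, rho i (a g w) = a (psi g) (rho i w)) ->
  let O := act_orbit a H v in
  w \in O -> rho i w \in O -> (#|O| <= 2 * edges rho O O)%N.
Proof.
move=> idx psi_mor twist O wO rwO; have [H1 HM HV] := sgH.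
pose L : set G := fun g => H g /\ exists2 k, H k & psi k = g.
have idxL : index_le2 H L.
  have psi1 : psi 1%g = 1%g.
    by case: psi_mor => -[_ psiM]; apply: (mulgI (psi 1%g)); rewrite -psiM !mulg1.
  have psi_quot x y : ~ H x -> ~ H y ->
      exists2 k, H k & psi k = ((psi x)^-1 * psi y)%g.
    move=> nHx nHy; case: psi_mor => -[_ psiM].
      exists (x^-1 * y)%g; first exact: idx.
      rewrite psiM; congr mulg; apply: (mulgI (psi x)).
      by rewrite -psiM !mulgV.
    have nHV z : ~ H z -> ~ H z^-1%g by move=> nHz /HV; rewrite invgK.
    (* An anti-automorphism reverses products, so the right quotient is the one sent to the required
       left quotient. *)
    exists (y * x^-1)%g; first by rewrite -[y]invgK; apply: idx => //; apply: nHV.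
    rewrite psiM; congr mulg; apply: (mulgI (psi x)).
    by rewrite -psiM mulgV mulVg.
  have psi_onto x : H x -> ~ L x -> exists2 x', psi x' = x & ~ H x'.
    have [psi' _ psiK] : bijective psi by case: psi_mor => -[].
    move=> Hx nLx; exists (psi' x); first exact: psiK.
    by move=> Hx'; apply: nLx; split=> //; exists (psi' x).
  move=> x y Hx Hy nLx nLy; split; first by apply: HM => //; apply: HV.
  have [x' <- nHx'] := psi_onto x Hx nLx; have [y' <- nHy'] := psi_onto y Hy nLy.
  exact: psi_quot.
(* The L-orbit of [rho i w] has at least half the size of O and lies in both O and [rho i @: O], so
   each of its points ends an edge inside O. *)
have -> : #|O| = #|act_orbit a H (rho i w)| by rewrite (act_orbit_eq sgH rwO).
apply: leq_trans (card_act_orbit_index a _ idxL) _; rewrite leq_mul2l /=.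
apply: leq_trans (_ : #|O :&: rho i @^-1: O| <= _)%N; last first.
  by rewrite /edges (bigD1 i) //= leq_addr.
rewrite card_setI_imset; apply/subset_leq_card/subsetP => u.
case/act_orbitP=> g [Hg [k Hk ek]] <-; rewrite in_setI; apply/andP; split.
  rewrite -ek -twist; apply: imset_f; rewrite /O -(act_orbit_eq sgH wO).
  by apply/act_orbitP; exists k.
by rewrite /O -(act_orbit_eq sgH rwO); apply/act_orbitP; exists g.
Qed.

End EdgesInsideOrbits.

(** * Comparison of the two Cheeger constants *)

Section Comparison.
Variables (R : realType) (V : finType) (T : 'End(ell2 R V)) (d : nat).
Variables (rho : 'I_d -> {perm V}) (G : groupType) (a : left_action G V).
Hypothesis V_ge2 : (2 <= #|V|)%N.
Hypothesis T_sa : self_adjoint T.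
Hypothesis d_gt0 : (0 < d)%N.
Hypothesis T_perm : T = \sum_(i < d) permop R (rho i).
Hypothesis T_eig : ~~ passmx.leigenvalue T (- d%:R).
Hypothesis T_conn : 0 < cheeger T.
Hypothesis G_trans : transitive_on a [set: G]%classic.
Hypothesis G_comm : forall g : G,
  (actop R a g \o (T \o T) = (T \o T) \o actop R a g)%VF.

(** The argument common to both symmetry assumptions, each of which enters through the alternative
    on O. *)
Lemma cheeger_square_gt :
  (forall (H : set G) v, subgroup H -> index_le2 [set: G]%classic H ->
     let O := act_orbit a H v in
     edges rho O O = 0%N \/ (#|O| <= 2 * edges rho O O)%N) ->
  cheeger T ^+ 2 / (20 * d%:R) < cheeger (T \o T)%VF.
Proof.
move=> alternative; rewrite ltNge; apply/negP => le_eps.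
have dR_gt0 : 0 < d%:R :> R by rewrite ltr0n.
have [A A_half eA] := cheeger2_attained T_sa T_perm d_gt0 V_ge2.
set eps := cheeger _ in le_eps eA.
have eps_le : 20 * d%:R * eps <= cheeger T ^+ 2.
  by move: le_eps; rewrite ler_pdivlMr ?mulr_gt0 // mulrC.
(* G commutes with T^2, so every translate of A also minimizes the ratio and has its own partner. *)
have images g : exists Y, nearly_mapped rho eps (a g @^-1: A) Y.
  apply: edges2_nearly_mapped => //.
  rewrite card_preim_act -eA -preimsetC.
  suff -> : edges2 rho (a g @^-1: A) (a g @^-1: ~: A) = edges2 rho A (~: A) by [].
  apply/eqP; rewrite -(eqr_nat R[i]) -!(dot_edges2 T_sa T_perm); apply/eqP.
  exact: dot_preim_act.
have [H [v [sgH idxH cardO sparse]]] := sparse_half_orbit G_trans d_gt0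
  (edges_symmetric T_sa T_perm) (cheeger_expansion T_sa T_perm d_gt0)
  T_conn eps_le A_half images.
case: (alternative H v sgH idxH) => [eO0 | ]; last by move: cardO sparse; lia.
by case/negP: T_eig; apply: (bipartite_eigenvalue T_perm (ltnW V_ge2) cardO eO0).
Qed.

End Comparison.

Theorem theorem4p2 (R : realType) (V : finType) (T : 'End(ell2 R V)) (d : nat)
    (rho : 'I_d -> {perm V}) (G : groupType) (a : left_action G V)
    (V_ge2 : (2 <= #|V|)%N)
    (T_sa : self_adjoint T)
    (T_nat : forall u v : V,
        exists k : nat, dot (T (ind R [set v])) (ind R [set u]) = k%:R)
    (d_gt0 : (0 < d)%N)
    (T_vol : forall u : V, vol T [set u] = d%:R)
    (T_perm : T = \sum_(i < d) permop R (rho i))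
    (T_eig : ~~ passmx.leigenvalue T (- d%:R))
    (T_conn : 0 < cheeger T)
    (G_trans : transitive_on a [set: G]%classic)
    (G_comm : forall g : G,
        (actop R a g \o (T \o T) = (T \o T) \o actop R a g)%VF)
    (G_index2 : forall H : set G, index_two_subgroup H -> ~ transitive_on a H) :
  ((forall g : G, (actop R a g \o T = T \o actop R a g)%VF) ->
     cheeger (T \o T)%VF > cheeger T ^+ 2 / (20 * d%:R))
  /\
  (forall psi : 'I_d -> V -> G -> G,
     (forall i v, automorphism (psi i v) \/ antiautomorphism (psi i v)) ->
     (forall i v g,
        permop R (rho i) (actop R a g (ind R [set v])) =
        actop R a (psi i v g) (permop R (rho i) (ind R [set v]))) ->
     cheeger (T \o T)%VF > cheeger T ^+ 2 / (48 * d%:R)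
     /\
     ((forall i v (H : set G), index_two_subgroup H -> (psi i v @` H)%classic = H) ->
        cheeger (T \o T)%VF > cheeger T ^+ 2 / (20 * d%:R))).
Proof.
have gt_cheeger :=
  cheeger_square_gt V_ge2 T_sa d_gt0 T_perm T_eig T_conn G_trans G_comm.
split=> [comm | psi psi_mor twist].
  apply: gt_cheeger => H v sgH _ O.
  have [g X Y|->|le_O] := edges_orbit_invariant (a := a) (rho := rho) sgH v.
  - apply/eqP; rewrite -(eqr_nat R[i]) -!(dot_edges T_perm); apply/eqP.
    exact: dot_preim_act.
  - by left.
  - by right; apply: leq_trans le_O _; rewrite leq_pmull.
(* Both sides of the operator identity are indicators of single points, which must coincide. *)
have twistE i v g : rho i (a g v) = a (psi i v g) (rho i v).
  have act1 k u : a k^-1%g @^-1: [set u] = [set a k u].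
    by apply/setP => w; rewrite !inE (can2_eq (@actVK _ _ a k) (@actK _ _ a k)).
  have := twist i v g; rewrite !(permop_ind, actop_ind, imset_set1, act1).
  move=> /ffunP/(_ (rho i (a g v))); rewrite !ffunE !inE eqxx /=.
  by case: eqP => // _ /esym/eqP; rewrite eq_sym oner_eq0.
have gt20 : cheeger T ^+ 2 / (20 * d%:R) < cheeger (T \o T)%VF.
  apply: gt_cheeger => H v sgH idxH O.
  (* Either no edge lies inside O, or one edge from w to [rho i w] suffices for the twisted bound,
     with [psi i w]. *)
  case: (pickP (fun i => O :&: rho i @^-1: O != set0)) => [i|none]; last first.
    left; rewrite /edges big1 // => i _; apply/eqP; rewrite cards_eq0.
    exact: negbFE (none i).
  case/set0Pn=> w /setIP[wO]; rewrite inE => rwO; right.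
  exact: (edges_orbit_twisted sgH idxH (psi_mor i w) (twistE i w) wO rwO).
split=> //; apply: le_lt_trans gt20.
apply: ler_wpM2l; first exact: sqr_ge0.
by rewrite lef_pV2 ?posrE ?mulr_gt0 ?ltr0n // ler_wpM2r // ler_nat.
Qed.
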